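(* Let $\Gamma\subseteq\mathfrak{S}$ be a set of permutations, each of length at least $2$. Then \[ \sum_{n=0}^{\infty}\frac{A_{\Gamma,n}^{\mathrm{ides}}(s,t)}{(1-t)^{n+1}}x^{n}=\sum_{n=0}^{\infty}\left(\frac{tx}{(1-t)^{2}}+\frac{1}{1-t}\sum_{k=2}^{\infty}R_{\Gamma,k}^{\mathrm{ides}}(s-1,t)z^{k}\right)^{*\langle n\rangle} \] where $z=x/(1-t)$.
   Context: $\mathfrak{S}_n$ is the set of permutations of $[n]$ in one-line notation ($\mathfrak{S}_0$ = empty permutation), $\mathfrak{S}=\bigsqcup_n\mathfrak{S}_n$. $\operatorname{std}$ of a sequence of distinct integers replaces its letters by $1,2,\dots$ in order of size. For $\pi\in\mathfrak{S}_n$, $\sigma\in\mathfrak{S}_m$, an occurrence of $\sigma$ in $\pi$ is an $i\in[n-m+1]$ with $\operatorname{std}(\pi_i\cdots\pi_{i+m-1})=\sigma$; a marked occurrence of a pattern in $\Gamma$ is a pair $(i,\sigma)$, $\sigma\in\Gamma$, $i$ an occurrence of $\sigma$; $\operatorname{occ}_\Gamma(\pi)$ is the number of such pairs. A $\Gamma$-cluster on $\pi\in\mathfrak{S}_n$ is a nonempty set $c$ of marked occurrences such that for every $j\in[n-1]$ some $(i,\sigma)\in c$, $\sigma\in\mathfrak{S}_m$, has $i\le j<i+m-1$; $C_{\Gamma,\pi}$ is the set of these, $\operatorname{mk}_\Gamma(c)=|c|$. $\operatorname{des}(\pi)$ is the number of $i\in[n-1]$ with $\pi_i>\pi_{i+1}$,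 and $\operatorname{ides}(\pi)=\operatorname{des}(\pi^{-1})$. $A_{\Gamma,n}^{\mathrm{ides}}(s,t)=\sum_{\pi\in\mathfrak{S}_n}s^{\operatorname{occ}_\Gamma(\pi)}t^{\operatorname{ides}(\pi)+1}$ for $n\ge1$, $=1$ for $n=0$; $R_{\Gamma,k}^{\mathrm{ides}}(s,t)=\sum_{\pi\in\mathfrak{S}_k}t^{\operatorname{ides}(\pi)+1}\sum_{c\in C_{\Gamma,\pi}}s^{\operatorname{mk}_\Gamma(c)}$. The identity is in formal power series in $s,t,x$ where multiplication is ordinary in $s,x$ and the Hadamard product in $t$: $(\sum_n a_nt^n)*(\sum_n b_nt^n)=\sum_n a_nb_nt^n$; $f^{*\langle n\rangle}$ is the $n$-fold Hadamard product, $f^{*\langle0\rangle}=1/(1-t)$. Other expressions use ordinary multiplication. *)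

(* Defs.v *)
From HB Require Import structures.
From mathcomp Require Import all_boot all_order all_algebra all_fingroup.
From mathcomp Require Import boolp.
From mathcomp Require classical_sets.

Set Implicit Arguments.
Unset Strict Implicit.
Unset Printing Implicit Defensive.

Import GRing.Theory.
Local Open Scope ring_scope.

(** * Formal power series *)

Record fps (R : Type) := Fps { fps_coef :> nat -> R }.

Arguments Fps {R} _.

Lemma fpsP (R : Type) (f g : fps R) : (forall n, f n = g n) -> f = g.
Proof. by case: f g => [f] [g] /= /funext ->. Qed.

HB.instance Definition _ R := gen_eqMixin (fps R).
HB.instance Definition _ R := gen_choiceMixin (fps R).

Section FpsRing.
Context {R : comNzRingType}.
Implicit Types f g h : fps R.

Definition fps_zero : fps R := Fps (fun _ => 0).
Definition fps_opp f : fps R := Fps (fun n => - f n).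
Definition fps_add f g : fps R := Fps (fun n => f n + g n).
Definition fps_one : fps R := Fps (fun n => (n == 0)%:R).
Definition fps_mul f g : fps R :=
  Fps (fun n => \sum_(i < n.+1) f i * g (n - i)%N).

Fact fps_addA : associative fps_add.
Proof. by move=> f g h; apply: fpsP => n /=; rewrite addrA. Qed.
Fact fps_addC : commutative fps_add.
Proof. by move=> f g; apply: fpsP => n /=; rewrite addrC. Qed.
Fact fps_add0 : left_id fps_zero fps_add.
Proof. by move=> f; apply: fpsP => n /=; rewrite add0r. Qed.
Fact fps_addN : left_inverse fps_zero fps_opp fps_add.
Proof. by move=> f; apply: fpsP => n /=; rewrite addNr. Qed.

HB.instance Definition _ :=
  GRing.isZmodule.Build (fps R) fps_addA fps_addC fps_add0 fps_addN.

Let trunc N f : {poly R} := \poly_(i < N) f i.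

Let coef_trunc N f n : (n < N)%N -> (trunc N f)`_n = f n.
Proof. by move=> ltnN; rewrite coef_poly ltnN. Qed.

Let coef_mul_trunc N f g n :
  (n < N)%N -> (fps_mul f g) n = (trunc N f * trunc N g)`_n.
Proof.
move=> ltnN; rewrite coefM; apply: eq_bigr => -[i /= lein] _.
by rewrite !coef_trunc // ?(leq_ltn_trans _ ltnN) ?leq_subr.
Qed.

Fact fps_mulC : commutative fps_mul.
Proof.
by move=> f g; apply: fpsP => n; rewrite !(@coef_mul_trunc n.+1) // mulrC.
Qed.

Fact fps_mulA : associative fps_mul.
Proof.
move=> f g h; apply: fpsP => n.
transitivity ((trunc n.+1 f * (trunc n.+1 g * trunc n.+1 h))`_n).
  rewrite coefM; apply: eq_bigr => -[i /= lein] _.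
  by rewrite coef_trunc // -coef_mul_trunc // ltnS leq_subr.
rewrite mulrA coefM; apply: eq_bigr => -[i /= lein] _.
by rewrite coef_trunc ?ltnS ?leq_subr // -coef_mul_trunc.
Qed.

Fact fps_mul1 : left_id fps_one fps_mul.
Proof.
move=> f; apply: fpsP => n /=; rewrite big_ord_recl /= mul1r subn0.
by rewrite big1 ?addr0 // => i _; rewrite mul0r.
Qed.

Fact fps_mulDl : left_distributive fps_mul fps_add.
Proof.
move=> f g h; apply: fpsP => n /=; rewrite -big_split /=.
by apply: eq_bigr => i _; rewrite mulrDl.
Qed.

Fact fps_one_neq0 : fps_one != 0.
Proof.
by apply/eqP => /(congr1 (fun f => f 0)) /= /eqP; rewrite oner_eq0.
Qed.

HB.instance Definition _ := GRing.Zmodule_isComNzRing.Build (fps R)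
  fps_mulA fps_mulC fps_mul1 fps_mulDl fps_one_neq0.

(* [f^-1] is the ring inverse of an invertible series [f]; as usual in the
   library, [f^-1 = f] when [f] is not invertible. *)
Definition fps_unit : {pred fps R} := fun f => `[< exists g, g * f = 1 >].
Definition fps_inv f : fps R := classical_sets.xget f (fun g => g * f = 1).

Fact fps_mulV : {in fps_unit, left_inverse 1 fps_inv *%R}.
Proof. by move=> f /asboolP /(@classical_sets.xgetPex _ f (fun g => g * f = 1)). Qed.
Fact fps_unitP f g : g * f = 1 -> fps_unit f.
Proof. by move=> gf; apply/asboolP; exists g. Qed.
Fact fps_inv_out : {in [predC fps_unit], fps_inv =1 id}.
Proof.
move=> f /asboolPn nf; rewrite /fps_inv; case: classical_sets.xgetP => // g _ /= gf.
by case: nf; exists g.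
Qed.

HB.instance Definition _ := GRing.ComNzRing_hasMulInverse.Build (fps R)
  fps_mulV fps_unitP fps_inv_out.

Definition fpsC (c : R) : fps R := Fps (fun n => c *+ (n == 0)).
Definition fpsX : fps R := Fps (fun n => (n == 1)%:R).

End FpsRing.

(** * Series in three variables *)

(* Z[[s]][[t]][[x]]: the coefficient of s^i t^j x^k in f is f k j i *)
Notation series3 := (fps (fps (fps int))).

Definition var_s : series3 := fpsC (fpsC fpsX).
Definition var_t : series3 := fpsC fpsX.
Definition var_x : series3 := fpsX.

Fact unit_1Bt : 1 - var_t \is a GRing.unit.
Proof.
apply/asboolP; exists (fpsC (Fps (fun=> 1))).
apply: fpsP => k; rewrite /= big_ord_recl /= big1 => [|i _]; last first.
  by rewrite mulr0n mul0r.
rewrite addr0 subn0 mulr1n; case: k => [|k] /=; last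
  by rewrite mulr0n subr0 mulr0.
rewrite mulr1n; apply: fpsP => j /=.
under eq_bigr do rewrite mul1r; case: j => [|j].
  by rewrite big_ord1 /= subr0.
rewrite !big_ord_recr /= subnn /= subr0.
have -> : (j.+1 - j = 1)%N by rewrite subSnn.
rewrite big1 => [|i _]; first by rewrite add0r sub0r addNr.
have -> : (j.+1 - i = (j - i).-1.+2)%N
  by rewrite subSn ?prednK ?subn_gt0 // ltnW.
by rewrite /= subr0.
Qed.

(* [u m + u m.+1 + ...] converges to [S]: each coefficient of the partial sums
   is eventually equal to that of [S]. *)
Definition is_sum3 (m : nat) (u : nat -> series3) (S : series3) : Prop :=
  forall i j k : nat, exists N0 : nat, forall N : nat, (N0 <= N)%N ->
    (\sum_(m <= n < N) u n) k j i = S k j i.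

Definition summable3 (m : nat) (u : nat -> series3) : Prop :=
  exists S, is_sum3 m u S.

Definition sum3 (m : nat) (u : nat -> series3) : series3 :=
  classical_sets.xget 0 (is_sum3 m u).

Lemma is_sum3_unique m u S S' : is_sum3 m u S -> is_sum3 m u S' -> S = S'.
Proof.
move=> uS uS'; apply: fpsP => k; apply: fpsP => j; apply: fpsP => i.
have [N HN] := uS i j k; have [N' HN'] := uS' i j k.
by rewrite -(HN (maxn N N')) ?leq_maxl // (HN' _ (leq_maxr N N')).
Qed.

Lemma sum3E m u S : is_sum3 m u S -> sum3 m u = S.
Proof.
move=> uS; apply: is_sum3_unique (uS).
exact: (@classical_sets.xgetPex _ 0 (is_sum3 m u)) (ex_intro _ S uS).
Qed.

Definition hadamard (f g : series3) : series3 :=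
  Fps (fun k => Fps (fun j => \sum_(i < k.+1) f i j * g (k - i)%N j)).

Definition hadamard_exp (f : series3) (n : nat) : series3 :=
  iterop n hadamard f (1 - var_t)^-1.

(** * Permutations and consecutive patterns *)

Definition one_line n (p : 'S_n) : seq nat := [seq (p i).+1 | i <- enum 'I_n].

Definition std (w : seq nat) : seq nat :=
  [seq count (fun y => y <= x)%N w | x <- w].

Definition des n (p : 'S_n) : nat :=
  count (fun i => nth 0 (one_line p) i > nth 0 (one_line p) i.+1)%N
        (iota 0 n.-1).

Definition ides n (p : 'S_n) : nat := des (p^-1)%g.

(* Positions are numbered from 0. *)
Definition is_occ n (p : 'S_n) m (q : 'S_m) (i : nat) : bool :=
  (i + m <= n)%N && (std (take m (drop i (one_line p))) == one_line q).

(* A pair (i, q), stored together with the length of q; a pattern occurring in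
   a permutation of length n has length at most n. *)
Definition mark (n : nat) : finType :=
  {m : 'I_n.+1 & ('I_n.+1 * 'S_m)%type}.

Definition mark_len n (a : mark n) : nat := tag a.
Definition mark_pos n (a : mark n) : nat := (tagged a).1.
Definition mark_pat n (a : mark n) : 'S_(mark_len a) := (tagged a).2.

(* A set of permutations G is given by its elements G m of each length m. *)
Section Patterns.
Context (G : forall m, {set 'S_m}).

Definition marked_occs n (p : 'S_n) : {set mark n} :=
  [set a : mark n |
    (mark_pat a \in G (mark_len a)) && is_occ p (mark_pat a) (mark_pos a)].

Definition occ n (p : 'S_n) : nat := #|marked_occs p|.

Definition clusters n (p : 'S_n) : {set {set mark n}} :=
  [set c : {set mark n} | [&& c != set0, c \subset marked_occs p &
    [forall j : 'I_n.-1, exists a in c,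
      (mark_pos a <= j)%N && (j < mark_pos a + mark_len a - 1)%N]]].

Definition A_ides {K : comNzRingType} (n : nat) (s t : K) : K :=
  if n == 0%N then 1
  else \sum_(p : 'S_n) s ^+ occ p * t ^+ (ides p).+1.

Definition R_ides {K : comNzRingType} (k : nat) (s t : K) : K :=
  \sum_(p : 'S_k) t ^+ (ides p).+1 * \sum_(c in clusters p) s ^+ #|c|.

End Patterns.

(* Main.v *)
(** Both sides are compared coefficientwise in [t]. The coefficient of [t^j] in
    [t^(ides p + 1) / (1 - t)^(n + 1)] is the number of words of length [n] over
    a [j]-letter alphabet whose standardization is [p], and standardization is
    compatible with passing to consecutive factors. Hence the coefficient of
    [t^j x^n] on the left enumerates words of length [n] by pattern occurrences,
    while on the right the Hadamard powers become ordinary powers and [f]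
    enumerates the blocks of words: single letters, and words carrying a cluster.
    As [s^occ = (1 + (s - 1))^occ] is a sum over sets of marked occurrences, it
    remains to cut a marked word after its first block, as in the
    Goulden-Jackson cluster method. *)

Require Import Defs.
From HB Require Import structures.
From mathcomp Require Import all_boot all_order all_algebra all_fingroup.
From mathcomp Require Import zify.
From mathcomp Require boolp.
Import GRing.Theory.

Set Implicit Arguments.
Unset Strict Implicit.
Unset Printing Implicit Defensive.

(** * Coefficients of power series *)

Section PowerSeries.
Local Open Scope ring_scope.
Context {R : comNzRingType}.
Implicit Types (f g : fps R) (c d : R) (k n : nat).

Lemma fpsD_coef f g n : (f + g) n = f n + g n.
Proof. by []. Qed.

Lemma fpsB_coef f g n : (f - g) n = f n - g n.
Proof. by []. Qed.

Lemma fps1_coef n : (1 : fps R) n = (n == 0%N)%:R.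
Proof. by []. Qed.

Lemma fpsM_coef f g n : (f * g) n = \sum_(i < n.+1) f i * g (n - i)%N.
Proof. by []. Qed.

Lemma fps_sum_coef I (r : seq I) (P : pred I) (F : I -> fps R) n :
  (\sum_(i <- r | P i) F i) n = \sum_(i <- r | P i) F i n.
Proof. exact: (big_morph (fun f : fps R => f n)). Qed.

Fact fpsC_zmod_morphism : zmod_morphism (@fpsC R).
Proof.
by move=> c d; apply: fpsP => n; rewrite /= mulrnBl.
Qed.

Fact fpsC_monoid_morphism : monoid_morphism (@fpsC R).
Proof.
split=> [|c d]; first by apply: fpsP => -[|n].
apply: fpsP => n; rewrite fpsM_coef /= big_ord_recl /= subn0 mulr1n.
rewrite big1 => [|i _]; last by rewrite mulr0n mul0r.
by rewrite addr0 mulrnAr.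
Qed.

HB.instance Definition _ :=
  GRing.isZmodMorphism.Build R (fps R) (@fpsC R) fpsC_zmod_morphism.
HB.instance Definition _ :=
  GRing.isMonoidMorphism.Build R (fps R) (@fpsC R) fpsC_monoid_morphism.

Lemma fpsCM_coef c f n : (fpsC c * f) n = c * f n.
Proof.
rewrite fpsM_coef big_ord_recl /= subn0 mulr1n big1 ?addr0 // => i _.
by rewrite mulr0n mul0r.
Qed.

Lemma fpsXM_coef f n : (fpsX * f) n = if n is k.+1 then f k else 0.
Proof.
rewrite fpsM_coef big_ord_recl /= mul0r add0r.
case: n => [|n]; first by rewrite big_ord0.
rewrite big_ord_recl /= mul1r subSS subn0 big1 ?addr0 // => i _.
by rewrite mul0r.
Qed.

Lemma fpsXn_coef k n : (fpsX ^+ k : fps R) n = (n == k)%:R.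
Proof.
elim: k n => [|k IHk] [|n] //; rewrite exprS fpsXM_coef // IHk.
Qed.

Lemma fps_exp_coef_lt f n k : f 0 = 0 -> (k < n)%N -> (f ^+ n) k = 0.
Proof.
move=> f0; elim: n k => // n IHn k ltkn.
rewrite exprS fpsM_coef big_ord_recl f0 mul0r add0r big1 // => i _.
rewrite IHn ?mulr0 //= /bump /=.
case: k ltkn i => [|k] ltkn [i ltik] //=.
by rewrite add1n subSS (leq_ltn_trans (leq_subr _ _)).
Qed.

(** The equation for [g] says that it inverts [1 - f], so the partial sum equals [g - f ^+ n * g].
    Since [f] has no constant term, the correction starts in degree [n] or later. *)
Lemma fps_geometric_coef f g n k :
  f 0 = 0 -> g = 1 + f * g -> (k < n)%N -> (\sum_(i < n) f ^+ i) k = g k.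
Proof.
move=> f0 gE ltkn.
have g1 : (1 - f) * g = 1 by rewrite mulrBl mul1r {1}gE addrK.
have -> : \sum_(i < n) f ^+ i = g - f ^+ n * g.
  rewrite -[LHS]mul1r -g1 mulrAC -opprB mulNr -subrX1 opprB.
  by rewrite mulrBl mul1r.
rewrite fpsB_coef fpsM_coef big1 ?subr0 // => i _.
by rewrite fps_exp_coef_lt ?mul0r // (leq_trans _ ltkn).
Qed.

Definition geom : fps R := Fps (fun=> 1).

Lemma mul_1BX_geom : (1 - fpsX) * geom = 1.
Proof.
apply: fpsP => n; rewrite mulrBl mul1r fpsB_coef fpsXM_coef fps1_coef.
by case: n => [|n] /=; rewrite ?subr0 ?subrr.
Qed.

Lemma geomM_coef f n : (geom * f) n = \sum_(i < n.+1) f i.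
Proof.
rewrite mulrC fpsM_coef; apply: eq_bigr => i _.
by rewrite mulr1.
Qed.

End PowerSeries.

(** * Series in three variables, read one coefficient at a time *)

Section Series3.
Local Open Scope ring_scope.

Lemma inv_1Bt : (1 - var_t)^-1 = fpsC geom.
Proof.
have gt : (1 - var_t) * fpsC geom = 1.
  by rewrite -(rmorph1 fpsC) -rmorphB -rmorphM mul_1BX_geom rmorph1.
by apply: (mulrI unit_1Bt); rewrite mulrV ?unit_1Bt.
Qed.

Lemma var_sB1 : var_s - 1 = fpsC (fpsC (fpsX - 1)).
Proof. by rewrite !rmorphB !rmorph1. Qed.

(** Only the term [n = k] reaches the coefficient of $x^k$, so the partial sums are stable from
    [k.+1] on. *)
Lemma is_sum3_x m (c : nat -> fps (fps int)) :
  is_sum3 m (fun n => fpsC (c n) * var_x ^+ n)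
    (Fps (fun n => if (m <= n)%N then c n else 0)).
Proof.
move=> i j k; exists k.+1 => N ltkN; rewrite fps_sum_coef.
under eq_bigr => n _ do rewrite fpsCM_coef fpsXn_coef.
congr (fps_coef (fps_coef _ j) i); rewrite [RHS]/=.
have [lemk|ltkm] := leqP m k; last first.
  rewrite big_nat_cond big1 // => n /andP[/andP[lemn _] _].
  by rewrite (ltn_eqF (leq_trans ltkm lemn)) // mulr0.
rewrite (bigD1_seq k) ?mem_index_iota ?lemk ?iota_uniq //= eqxx mulr1.
by rewrite big1 ?addr0 // => n; rewrite eq_sym => /negPf->; rewrite mulr0.
Qed.

(** The Hadamard product treats each power of $t$ separately: for fixed [j] it is the ordinary
    product of series in $x$. The convention for [n = 0] fits, because every $t$-coefficient of
    $1/(1-t)$ is 1. *)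
Lemma hadamard_exp_coef (f : series3) n k j :
  hadamard_exp f n k j = (Fps (fun k => f k j) ^+ n) k.
Proof.
case: n => [|n].
  by rewrite /hadamard_exp /= inv_1Bt; case: k => [|k].
rewrite /hadamard_exp iteropS; elim: n k => [|n IHn] k; first by rewrite expr1.
by rewrite iterS exprS fpsM_coef; apply: eq_bigr => i _; rewrite IHn.
Qed.

(** For each [j] the recursion is the equation $g = 1 + f_j g$ in the variable $x$, which
    characterizes the geometric series of $f_j$. *)
Lemma is_sum3_hadamard_exp (f : series3) (a : nat -> nat -> fps int) :
  (forall j, f 0 j = 0) ->
  (forall j, a j 0 = 1) ->
  (forall j n, a j n.+1 = \sum_(k < n.+1) f k.+1 j * a j (n - k)%N) ->
  is_sum3 0 (hadamard_exp f) (Fps (fun n => Fps (fun j => a j n))).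
Proof.
move=> f0 a0 aS i j k; exists k.+1 => N ltkN.
rewrite big_mkord !fps_sum_coef.
under eq_bigr => n _ do rewrite hadamard_exp_coef.
rewrite -!fps_sum_coef; congr (fps_coef _ i).
apply: (@fps_geometric_coef _ _ (Fps (a j)) N k) => //=.
apply: fpsP => -[|n].
  by rewrite fpsD_coef fpsM_coef big_ord1 /= f0 mul0r addr0 a0.
rewrite fpsD_coef fps1_coef fpsM_coef big_ord_recl /= f0 mul0r !add0r aS.
by [].
Qed.

End Series3.

(** * Sets of intervals covering a segment *)

Section Covers.
Context (K : comNzRingType) (y : K).

(** The product over [T] of [y + 1] inside [M] and [0 + 1] outside expands into a sum over all
    subsets, where those not contained in [M] contribute 0. *)
Lemma sum_subset_expr (T : finType) (M : {set T}) :
  (\sum_(S : {set T} | S \subset M) y ^+ #|S| = (1 + y) ^+ #|M|)%R.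
Proof.
transitivity (\prod_(a : T) ((if a \in M then y else 0) + 1) : K)%R; last first.
  rewrite (bigID [in M]) /= [X in (_ * X)%R]big1 => [|a /negPf ->];
    last exact: add0r.
  rewrite mulr1 -prodr_const; apply: eq_bigr => a ->; exact: addrC.
rewrite bigA_distr big_mkcond; apply: eq_bigr => S _ /=.
rewrite -big_mkcond /=; case: ifPn => [SM|/subsetPn[a aS aM]].
  by rewrite -prodr_const; apply: eq_bigr => a /(subsetP SM) ->.
by rewrite (bigD1 a) //= (negPf aM) mul0r.
Qed.

(** The number [g] stands for the gap between positions [g] and [g.+1] of a word; intervals of gaps
    are half-open. *)
Definition covered (T : finType) (lo hi : T -> nat) (S : {set T}) (g : nat) :=
  [exists a in S, lo a <= g < hi a].

Definition covering (T : finType) (lo hi : T -> nat) (S : {set T}) (k : nat) :=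
  [forall g : 'I_k, covered lo hi S g].

Definition cover_poly (T : finType) (lo hi : T -> nat) (M : {set T}) k : K :=
  (\sum_(S : {set T} | (S \subset M) && covering lo hi S k) y ^+ #|S|)%R.

(** Used to pass between two encodings of marked occurrences: taking images matches the subsets of
    [M] with those of its image and keeps sizes and covered gaps. *)
Lemma cover_poly_imset (T T' : finType) (lo hi : T -> nat) (lo' hi' : T' -> nat)
    (f : T -> T') (M : {set T}) k :
  {in M &, injective f} -> {in M, forall a, lo' (f a) = lo a} ->
  {in M, forall a, hi' (f a) = hi a} ->
  cover_poly lo' hi' (f @: M) k = cover_poly lo hi M k.
Proof.
move=> finj flo fhi; rewrite /cover_poly.
rewrite (reindex_onto (fun S : {set T} => f @: S)
  (fun S' : {set T'} => M :&: f @^-1: S')) /=; last first.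
  move=> S' /andP[S'M _]; apply/setP=> b; apply/imsetP/idP.
    by case=> a; rewrite !inE => /andP[_ ?] ->.
  move=> bS; have /imsetP[a aM eb] := subsetP S'M b bS.
  by exists a => //; rewrite !inE aM -eb.
have fK (S : {set T}) : S \subset M -> M :&: f @^-1: (f @: S) = S.
  move=> SM; apply/setP=> a; rewrite !inE; apply/andP/idP => [[aM]|aS].
    by case/imsetP=> b bS /finj -> //; apply: (subsetP SM).
  by rewrite (subsetP SM) // imset_f.
have covE (S : {set T}) g :
    S \subset M -> covered lo' hi' (f @: S) g = covered lo hi S g.
  move=> SM; apply/exists_inP/exists_inP => [[_ /imsetP[a aS ->]]|[a aS]] ag.
    by exists a => //; rewrite -flo -?fhi ?(subsetP SM).
  by exists (f a); rewrite ?imset_f // flo ?fhi ?(subsetP SM).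
apply: eq_big => [S|S].
  have [SM|SM] /= := boolP (S \subset M); last first.
    apply: contraNF SM => /andP[_ /eqP <-]; exact: subsetIl.
  rewrite imsetS // fK // eqxx andbT.
  by apply: eq_forallb => g; rewrite covE.
move=> /andP[_ /eqP SE]; rewrite card_in_imset // => a b aS bS.
by apply: finj; [move: aS | move: bS]; rewrite -SE inE => /andP[].
Qed.

Context (T : finType) (lo hi : T -> nat) (M : {set T}) (n : nat).
Hypothesis lo_le_hi : {in M, forall a, lo a <= hi a}.
Hypothesis hi_le : {in M, forall a, hi a <= n}.

(** When all of [0, ..., n - 1] are covered, [find] returns [n], which is itself uncovered for [S]
    inside [M], since no interval of [M] ends beyond [n]. *)
Let first_gap (S : {set T}) : nat :=
  find (fun g => ~~ covered lo hi S g) (iota 0 n).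

Let first_gap_le S : first_gap S < n.+1.
Proof. by rewrite ltnS -[leqRHS](size_iota 0) find_size. Qed.

Let first_gapE (S : {set T}) k : S \subset M -> k <= n ->
  (first_gap S == k) = covering lo hi S k && ~~ covered lo hi S k.
Proof.
move=> SM lekn.
have cov_lt g : g < first_gap S -> covered lo hi S g.
  move=> ltg; have ltgn : g < n by rewrite (leq_trans ltg) // -ltnS.
  by have := before_find 0 ltg; rewrite nth_iota // add0n => /negbFE.
have ncov : ~~ covered lo hi S (first_gap S).
  have [ltn|] := boolP (first_gap S < n).
    have hs : has (fun g => ~~ covered lo hi S g) (iota 0 n).
      by rewrite has_find size_iota.
    by have := nth_find 0 hs; rewrite nth_iota.
  rewrite -leqNgt => len; apply/exists_inPn => a /(subsetP SM) aM.
  by rewrite negb_and -!leqNgt orbC (leq_trans (hi_le aM)).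
apply/eqP/andP => [<-|[/forallP cov ncovk]].
  by split=> //; apply/forallP => g; apply: cov_lt.
case: (ltngtP (first_gap S) k) => // lt.
  by have := cov (Ordinal lt); rewrite (negPf ncov).
by rewrite cov_lt in ncovk.
Qed.

(* A set of intervals splits at its first uncovered point k into the intervals
   ending before k, which cover everything up to k, and the arbitrary set of
   those starting after k. *)
Lemma sum_subset_first_gap :
  ((1 + y) ^+ #|M| =
   \sum_(k < n.+1) cover_poly lo hi [set a in M | (hi a <= k)%N] k *
     (1 + y) ^+ #|[set a in M | (k < lo a)%N]|)%R.
Proof.
rewrite -sum_subset_expr.
rewrite (partition_big (fun S : {set T} => Ordinal (first_gap_le S)) predT) //=.
apply: eq_bigr => k _; rewrite -sum_subset_expr /cover_poly big_distrlr pair_big /=.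
set A := [set a in M | hi a <= k]; set B := [set a in M | k < lo a].
have lekn : k <= n by rewrite -ltnS.
have disjAB a : a \in A -> a \in B -> False.
  rewrite !inE => /andP[aM ak] /andP[_ ka].
  by have := leq_trans ka (leq_trans (lo_le_hi aM) ak); rewrite ltnn.
(* [A] and [B] are disjoint, and an interval avoiding the gap [k] lies in one of them, so union and
   intersection with [A] and [B] are mutually inverse. *)
rewrite (reindex_onto (fun P : {set T} * {set T} => P.1 :|: P.2)
  (fun S : {set T} => (S :&: A, S :&: B))) /=; last first.
  move=> S /andP[SM]; rewrite -val_eqE /= first_gapE // => /andP[_ ncov].
  rewrite -setIUr; apply/setIidPl/subsetP => a aS.
  have aM := subsetP SM a aS.
  move/exists_inPn: ncov => /(_ a aS); rewrite !inE aM /= negb_and -leqNgt -ltnNge.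
  by case/orP => ->; rewrite ?orbT.
apply: eq_big => [[S1 S2]|[S1 S2]] /=; last first.
  case/andP=> _ /eqP[E1 E2]; rewrite -exprD -cardsUI.
  suff -> : S1 :&: S2 = set0 by rewrite cards0 addn0.
  apply/setP => a; rewrite [RHS]inE -E1 -E2.
  apply/negP => /setIP[/setIP[_ aA] /setIP[_ aB]]; exact: disjAB aA aB.
rewrite -val_eqE /=.
have [S1A|S1A] /= := boolP (S1 \subset A); last first.
  apply: contraNF S1A => /andP[_ /eqP[<- _]]; exact: subsetIr.
have [S2B|S2B] /= := boolP (S2 \subset B); last first.
  rewrite andbF; apply: contraNF S2B => /andP[_ /eqP[_ <-]]; exact: subsetIr.
have AM : A \subset M by apply/subsetP=> a; rewrite inE => /andP[].
have BM : B \subset M by apply/subsetP=> a; rewrite inE => /andP[].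
have SM : S1 :|: S2 \subset M.
  by rewrite subUset (subset_trans S1A) // (subset_trans S2B).
have A2 : S2 :&: A = set0.
  apply/setP=> a; rewrite [RHS]inE; apply/negP => /setIP[/(subsetP S2B) aB aA].
  exact: disjAB aA aB.
have B1 : S1 :&: B = set0.
  apply/setP=> a; rewrite [RHS]inE; apply/negP => /setIP[/(subsetP S1A) aA aB].
  exact: disjAB aA aB.
rewrite SM first_gapE // !setIUl A2 B1 setU0 set0U.
rewrite (setIidPl S1A) (setIidPl S2B) eqxx !andbT andbC.
have -> : ~~ covered lo hi (S1 :|: S2) k.
  apply/exists_inPn => a /setUP[/(subsetP S1A)|/(subsetP S2B)];
    rewrite inE => /andP[_].
    by rewrite negb_and -!leqNgt orbC => ->.
  by rewrite negb_and -!ltnNge => ->.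
(* The intervals in [S2] start after [k] and cannot cover a gap below [k]. *)
rewrite !andbT; apply: eq_forallb => g.
apply/exists_inP/exists_inP => -[a aS ag]; exists a => //.
  case/setUP: aS => // /(subsetP S2B); rewrite inE => /andP[_ ka].
  case/andP: ag => /(leq_trans ka) /ltnW.
  by rewrite leqNgt ltn_ord.
by rewrite inE aS.
Qed.

End Covers.

(** * Words and standardization *)

Section TupleBigops.
Context (R : Type) (idx : R) (op : Monoid.com_law idx) (T : finType).

Lemma big_tuple0 (F : seq T -> R) :
  \big[op/idx]_(w : 0.-tuple T) F w = F [::].
Proof. by rewrite (big_pred1 [tuple]) // => w; apply/esym/eqP/tuple0. Qed.

Lemma big_tuple_cons n (F : seq T -> R) :
  \big[op/idx]_(w : n.+1.-tuple T) F w =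
  \big[op/idx]_(x : T) \big[op/idx]_(v : n.-tuple T) F (x :: v).
Proof.
rewrite pair_big /= (reindex (fun P : T * n.-tuple T => cons_tuple P.1 P.2)) //=.
exists (fun w => (thead w, behead_tuple w)) => [[x v]|w] _ /=.
  by congr pair; apply: val_inj.
by rewrite [RHS]tuple_eta; apply: val_inj.
Qed.

Lemma big_tuple_cat k l (F : seq T -> R) :
  \big[op/idx]_(w : (k + l).-tuple T) F w =
  \big[op/idx]_(u : k.-tuple T) \big[op/idx]_(v : l.-tuple T) F (u ++ v).
Proof.
pose F2 (F : seq T -> R) u := \big[op/idx]_(v : l.-tuple T) F (u ++ v).
elim: k F => [|k IHk] F; first by rewrite (big_tuple0 (F2 F)).
rewrite (big_tuple_cons _ (F2 F)) addSn big_tuple_cons.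
by apply: eq_bigr => x _; apply: (IHk (fun w => F (x :: w))).
Qed.

End TupleBigops.

Lemma seq_enum_ord m (v : seq nat) :
  size v = m -> v = [seq nth 0 v (a : 'I_m) | a <- enum 'I_m].
Proof.
move=> sv; rewrite (map_comp (nth 0 v) val) val_enum_ord.
by rewrite map_nth_iota0 ?sv // -sv take_size.
Qed.

Lemma count_enum (T : finType) (P : pred T) : count P (enum T) = #|P|.
Proof. by rewrite cardE -size_filter enumT. Qed.

(** Serves to recover the values of a permutation from the comparisons between them. *)
Lemma card_perm_lt m (q : 'S_m) k : k <= m -> #|[pred b | q b < k]| = k.
Proof.
move=> lekm; rewrite -sum1_card (reindex_inj (@perm_inj _ (q^-1)%g)) /=.
under eq_bigl => b do rewrite inE permKV.
by rewrite -(big_ord_widen m (fun=> 1)) // sum1_card card_ord.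
Qed.

Lemma nth_one_line n (p : 'S_n) (i : 'I_n) : nth 0 (one_line p) i = (p i).+1.
Proof. by rewrite (nth_map i) ?size_enum_ord // nth_ord_enum. Qed.

Lemma size_one_line n (p : 'S_n) : size (one_line p) = n.
Proof. by rewrite size_map size_enum_ord. Qed.

(** The number of letters that are at most a given letter grows strictly with that letter, so
    [std v] has the same comparisons as [v], and comparisons determine [q]. *)
Lemma std_eq_one_line m (q : 'S_m) (v : seq nat) : size v = m ->
  (std v == one_line q) =
  [forall a : 'I_m, forall b : 'I_m, (q a < q b) == (nth 0 v a < nth 0 v b)].
Proof.
move=> sv; pose c (a : 'I_m) := #|[pred b : 'I_m | nth 0 v b <= nth 0 v a]|.
have cE (a : 'I_m) : count (fun y => y <= nth 0 v a) v = c a.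
  rewrite [in X in count _ X](seq_enum_ord sv) count_map count_enum.
  exact: eq_card.
have stdE : std v = [seq c a | a <- enum 'I_m].
  rewrite /std [in X in map _ X](seq_enum_ord sv) -map_comp.
  by apply: eq_map => a; rewrite /= cE.
have c_mono a b : (c a < c b) = (nth 0 v a < nth 0 v b).
  have [lt|le] := ltnP (nth 0 v a) (nth 0 v b).
    apply/proper_card/properP; split.
      by apply/subsetP => x; rewrite !inE => /leq_trans; apply; apply: ltnW.
    by exists b; rewrite !inE ?leqnn // -ltnNge.
  apply/negbTE; rewrite -leqNgt subset_leq_card //; apply/subsetP => x.
  by rewrite !inE => /leq_trans; apply.
rewrite stdE; apply/eqP/'forall_'forall_eqP => [/eq_in_map cq a b | qv].
  by rewrite -c_mono !cq ?mem_enum.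
apply: eq_map => a; rewrite -[RHS](card_perm_lt q (ltn_ord (q a))).
by apply: eq_card => b; rewrite !inE ltnS leqNgt -qv -leqNgt.
Qed.

(* Letters are ranked from the largest to the smallest, equal letters from left
   to right; this reversal of the alphabet does not affect any count, and makes
   the words with a given standardization correspond to the weakly decreasing
   words bounded by the size of the alphabet. *)
Definition before (u : seq nat) (a b : nat) : bool :=
  (nth 0 u b < nth 0 u a) || (nth 0 u a == nth 0 u b) && (a < b).

Lemma before_irr u a : before u a a = false.
Proof. by rewrite /before !ltnn andbF. Qed.

Lemma before_trans u b a c : before u a b -> before u b c -> before u a c.
Proof.
rewrite /before => /orP[lt1|/andP[/eqP-> lt1]] /orP[lt2|/andP[/eqP e2 lt2]].
- by rewrite (ltn_trans lt2 lt1).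
- by rewrite -e2 lt1.
- by rewrite lt2.
- by rewrite e2 eqxx (ltn_trans lt1 lt2) orbT.
Qed.

Lemma before_total u a b : a != b -> before u a b || before u b a.
Proof. by rewrite /before; case: ltngtP => //=; case: ltngtP. Qed.

(** Ranking by [before] is expressed through comparisons only, a form that restricts directly to
    factors of the word. *)
Definition standardizes n (p : 'S_n) (u : seq nat) : bool :=
  [forall a : 'I_n, forall b : 'I_n, (p a < p b) == before u a b].

Lemma standardizesP n (p : 'S_n) u :
  reflect (forall a b, (p a < p b) = before u a b) (standardizes p u).
Proof. exact: 'forall_'forall_eqP. Qed.

Lemma standardizes_uniq n (p q : 'S_n) u :
  standardizes p u -> standardizes q u -> p = q.
Proof.
move=> /standardizesP pu /standardizesP qu; apply/permP => a; apply: val_inj.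
rewrite -[LHS](card_perm_lt p (ltnW (ltn_ord _))).
rewrite -[RHS](card_perm_lt q (ltnW (ltn_ord _))).
by apply: eq_card => b; rewrite !inE pu qu.
Qed.

(** The rank of a position is the number of positions strictly before it; totality of [before] makes
    ranks distinct. *)
Lemma standardizes_exists n u : exists p : 'S_n, standardizes p u.
Proof.
pose r (a : 'I_n) := #|[pred b : 'I_n | before u b a]|.
have r_lt a : r a < n.
  rewrite -[n in _ < n]card_ord; apply/proper_card/properP; split.
    exact/subsetP.
  by exists a; rewrite !inE ?before_irr.
have r_mono (a b : 'I_n) : before u a b -> r a < r b.
  move=> ab; apply/proper_card/properP; split.
    by apply/subsetP => c; rewrite !inE => /before_trans; apply.
  by exists a; rewrite !inE ?before_irr.
have r_inj : injective (fun a => Ordinal (r_lt a)).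
  move=> a b [rab]; apply/eqP/contraT => /(before_total u).
  by case/orP => /r_mono; rewrite rab ltnn.
exists (perm r_inj); apply/standardizesP => a b; rewrite !permE /=.
have [ab|nab] := boolP (before u a b); first exact: r_mono.
have [->|/(before_total u)] := eqVneq a b; first exact: ltnn.
by rewrite (negPf nab) /= => /r_mono/ltnW; rewrite leqNgt => /negPf.
Qed.

(** Weakly decreasing continuations of [x], with a strict drop wherever [D] has [true]; the bound
    [x + ~~ b] is exclusive. *)
Fixpoint chain (x : nat) (D : seq bool) (v : seq nat) : bool :=
  match D, v with
  | b :: D', y :: v' => (y < x + ~~ b) && chain y D' v'
  | _, _ => true
  end.

Fixpoint nchain (D : seq bool) (x : nat) : nat :=
  if D is b :: D' then \sum_(y < x + ~~ b) nchain D' y else 1.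

Definition letters J (w : seq 'I_J) : seq nat := map val w.

(** Bounding the first letter suffices: any later one is at most its predecessor, which is already
    below [J]. *)
Lemma sum_chain J n D x :
  size D = n -> (forall b D', D = b :: D' -> x + ~~ b <= J) ->
  \sum_(v : n.-tuple 'I_J) chain x D (letters v) = nchain D x.
Proof.
elim: D n x => [|b D IHD] [|n] x //= => [_ _|[sD] xJ].
  by rewrite (big_tuple0 _ (fun=> 1)).
rewrite (big_tuple_cons _ _ (fun v => nat_of_bool (chain x (b :: D) (letters v)))) /=.
rewrite (big_ord_widen J) ?(xJ b D) // [RHS]big_mkcond /=.
apply: eq_bigr => y _; case: ifP => yx /=.
  rewrite -(IHD n) // => b' D' _.
  by rewrite (leq_trans _ (ltn_ord y)) // -addn1 leq_add2l; case: b'.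
exact: big1.
Qed.

Lemma chainP x D v : size v = size D ->
  reflect
    (forall i, i < size D -> nth 0 v i < nth 0 (x :: v) i + ~~ nth false D i)
    (chain x D v).
Proof.
elim: D x v => [|b D IHD] x [|y v] //= => [_|[sv]]; first by constructor.
apply: (iffP andP) => [[yx /(IHD _ _ sv) H] [|i] //|H]; first exact: H.
by split; [apply: (H 0) | apply/(IHD _ _ sv) => i; apply: (H i.+1)].
Qed.

(** Each step of a chain sums over smaller values, which is multiplication by [geom]; a strict step
    shifts once more, by [fpsX]. *)
Lemma nchain_gf (K : comNzRingType) D j :
  ((fpsX ^+ count id D * geom ^+ (size D).+1 : fps K) j = (nchain D j)%:R)%R.
Proof.
elim: D j => [|b D IHD] j; first by rewrite mul1r.
have -> : (fpsX ^+ count id (b :: D) * geom ^+ (size (b :: D)).+1 =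
    geom * (fpsX ^+ b * (fpsX ^+ count id D * geom ^+ (size D).+1)) :> fps K)%R.
  by rewrite /= exprD [(geom ^+ (size D).+2)%R]exprS mulrCA -!mulrA.
rewrite geomM_coef [nchain _ _]/= natr_sum; case: b.
  rewrite addn0 big_ord_recl expr1 fpsXM_coef add0r.
  by apply: eq_bigr => i _; rewrite fpsXM_coef -IHD.
by rewrite addn1; apply: eq_bigr => i _; rewrite mul1r IHD.
Qed.

Definition descents n (p : 'S_n) : seq bool :=
  [seq nth 0 (one_line p) i > nth 0 (one_line p) i.+1 | i <- iota 0 n.-1].

(** Reading the letters of a word in the order prescribed by [p] gives a chain that drops strictly
    at the descents of [p^-1]. The leading [true], started at [J], only says that the first letter
    is below [J]. *)
Lemma sum_standardizes J n (p : 'S_n) : 0 < n ->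
  \sum_(w : n.-tuple 'I_J) standardizes p (letters w) =
  nchain (true :: descents p^-1) J.
Proof.
move=> n_gt0.
have sD : size (true :: descents p^-1) = n by rewrite /= size_map size_iota prednK.
rewrite -(@sum_chain J _ _ _ sD) => [|b D' [<- _]]; last by rewrite addn0.
pose perm_word (q : 'S_n) (v : n.-tuple 'I_J) := [tuple tnth v (q a) | a < n].
have pwE q v (a : 'I_n) : nth 0 (letters (perm_word q v)) a = tnth v (q a).
  rewrite (nth_map (tnth v a)) ?size_tuple //.
  by rewrite -tnth_nth tnth_mktuple.
rewrite (reindex (perm_word p)) /=; last first.
  exists (perm_word p^-1%g) => v _; apply: eq_from_tnth => a.
    by rewrite !tnth_mktuple permKV.
  by rewrite !tnth_mktuple permK.
apply: eq_bigr => v _; congr nat_of_bool.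
set s := one_line p^-1.
(* [B] is the order [before] carried to the rearranged word [v]: ties are broken by the original
   places, listed in [s]. *)
pose B i k := (nth 0 (letters v) k < nth 0 (letters v) i) ||
  (nth 0 (letters v) i == nth 0 (letters v) k) && (nth 0 s i < nth 0 s k).
have vE (i : 'I_n) : tnth v i = nth 0 (letters v) i :> nat.
  by rewrite (nth_map (tnth v i)) ?size_tuple // -tnth_nth.
have beforeE (a b : 'I_n) : before (letters (perm_word p v)) a b = B (p a) (p b).
  by rewrite /before /B !pwE !vE !nth_one_line !permK ltnS.
have B_irr i : B i i = false by rewrite /B !ltnn andbF.
have B_trans k i l : B i k -> B k l -> B i l.
  rewrite /B => /orP[lt1|/andP[/eqP-> lt1]] /orP[lt2|/andP[/eqP e2 lt2]].
  - by rewrite (ltn_trans lt2 lt1).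
  - by rewrite -e2 lt1.
  - by rewrite lt2.
  - by rewrite e2 eqxx (ltn_trans lt1 lt2) orbT.
have B_step i : i.+1 < n ->
    B i i.+1 = (nth 0 (letters v) i.+1 <
                nth 0 (letters v) i + ~~ (nth 0 s i.+1 < nth 0 s i)).
  move=> lti; have : nth 0 s i != nth 0 s i.+1.
    rewrite nth_uniq ?size_one_line ?(ltnW lti) //; first by rewrite neq_ltn leqnn.
    by rewrite map_inj_uniq ?enum_uniq // => a b [] /val_inj /perm_inj.
  rewrite /B; case: (ltngtP (nth 0 s i)) => //= _ _.
    by rewrite andbT addn1 ltnS [RHS]leq_eqVlt eq_sym orbC.
  by rewrite andbF orbF addn0.
have D_nth i : i.+1 < n ->
    nth false (descents p^-1) i = (nth 0 s i.+1 < nth 0 s i).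
  move=> lti; have lti' : i < n.-1 by rewrite -ltnS prednK.
  by rewrite (nth_map 0) ?size_iota // nth_iota.
have sv : size (letters v) = size (true :: descents p^-1).
  by rewrite sD size_map size_tuple.
apply/standardizesP/(chainP J sv) => [pB [|i]|chain_v a b].
- by rewrite sD /= addn0; rewrite -[X in nth _ _ X]/(val (Ordinal n_gt0)) -vE.
- rewrite sD => lti; rewrite [nth false _ _]/= D_nth // -B_step //.
  have := pB ((p^-1)%g (Ordinal (ltnW lti))) ((p^-1)%g (Ordinal lti)).
  by rewrite beforeE !permKV /= leqnn => <-.
(* By transitivity, comparisons of neighbours, which are the chain conditions, give all
   comparisons. *)
have B_lt i k : i < k -> k < n -> B i k.
  move=> ltik ltkn.
  apply: (@homo_ltn_in _ (gtn n) id B B_trans) => // [m1 m2 _ lt2 l|m _ ltm|].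
  - by case/andP=> _ /ltn_trans; apply.
  - rewrite B_step //; have := chain_v m.+1.
    by rewrite sD [nth false _ _]/= D_nth //; apply.
  - exact: ltn_trans ltkn.
rewrite beforeE; case: (ltngtP (p a) (p b)) => [ab|ba|->]; last 1 first.
- by rewrite B_irr.
- by rewrite B_lt.
- by apply/esym/negP => /B_trans/(_ (B_lt _ _ ba (ltn_ord _))); rewrite B_irr.
Qed.

(** * Pattern occurrences in words *)

(** Words are grouped by their standardization, and each group is counted by chains. The leading
    [true] of the chain accounts for the 1 added to [ides p]. *)
Lemma sum_words_gf (K : comNzRingType) J n (P : 'S_n -> K) (W : seq nat -> K) :
  0 < n -> (forall (p : 'S_n) u, size u = n -> standardizes p u -> W u = P p) ->
  (((\sum_(p : 'S_n) fpsC (P p) * fpsX ^+ (ides p).+1) * geom ^+ n.+1 : fps K) J =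
   \sum_(w : n.-tuple 'I_J) W (letters w))%R.
Proof.
move=> n_gt0 WP.
have W1 (w : n.-tuple 'I_J) :
    (W (letters w) = \sum_(p : 'S_n) P p *+ standardizes p (letters w))%R.
  have [p pw] := standardizes_exists n (letters w).
  rewrite (bigD1 p) //= pw big1 => [|q]; last first.
    case qw: (standardizes q (letters w)) => // /eqP[].
    exact: standardizes_uniq qw pw.
  by rewrite addr0; apply: WP => //; rewrite size_map size_tuple.
under [RHS]eq_bigr => w _ do rewrite W1.
rewrite exchange_big mulr_suml fps_sum_coef; apply: eq_bigr => p _.
rewrite sumrMnr sum_standardizes // -mulrA fpsCM_coef -mulr_natr -nchain_gf.
congr (_ * fps_coef (fpsX ^+ _ * geom ^+ _) J)%R.
  by rewrite /= add1n /ides /des count_map.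
by rewrite /= size_map size_iota prednK.
Qed.

Definition occurs m (q : 'S_m) (u : seq nat) (i : nat) : bool :=
  (i + m <= size u) && standardizes q (drop i u).

Lemma eq_standardizes m (q : 'S_m) u v :
  (forall a, a < m -> nth 0 u a = nth 0 v a) ->
  standardizes q u = standardizes q v.
Proof.
move=> uv; apply: eq_forallb => a; apply: eq_forallb => b.
by rewrite /before !uv.
Qed.

(** Standardization commutes with passing to a factor: shifting two positions by [i] does not change
    which one comes first when letters are equal. *)
Lemma is_occE n (p : 'S_n) m (q : 'S_m) u i :
  size u = n -> standardizes p u -> is_occ p q i = occurs q u i.
Proof.
move=> su /standardizesP pu; rewrite /is_occ /occurs su.
case: (leqP (i + m) n) => //= lein.
have lt_n (a : 'I_m) : i + a < n by rewrite (leq_trans _ lein) // ltn_add2l.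
rewrite std_eq_one_line; last first.
  rewrite size_takel // size_drop size_one_line.
  by rewrite leq_subRL ?(leq_trans (leq_addr _ _) lein).
apply: eq_forallb => a; apply: eq_forallb => b; congr (_ == _).
rewrite !nth_take // !nth_drop.
have := pu (Ordinal (lt_n a)) (Ordinal (lt_n b)).
rewrite -[X in nth 0 _ X < _]/(val (Ordinal (lt_n a))).
rewrite -[X in _ < nth 0 _ X]/(val (Ordinal (lt_n b))).
by rewrite !nth_one_line ltnS => ->; rewrite /before !nth_drop ltn_add2l.
Qed.

(** * Marked occurrences as intervals of gaps *)

Section Marks.
Context (G : forall m : nat, {set 'S_m}).
Hypothesis hG : forall m (q : 'S_m), q \in G m -> 2 <= m.

(** Only position and length are stored, as the word then determines the pattern. The bound [N] is
    independent of [u], so that a word and its factors share one type of marks. *)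
Definition marks N (u : seq nat) : {set 'I_N.+1 * 'I_N.+1} :=
  [set a : 'I_N.+1 * 'I_N.+1 | [exists q in G a.2, occurs q u a.1]].

Definition pair_lo N (a : 'I_N.+1 * 'I_N.+1) : nat := a.1.
(** A factor of length [m] at [i] contains the gaps [i, ..., i + m - 2]; the end is exclusive. *)
Definition pair_hi N (a : 'I_N.+1 * 'I_N.+1) : nat := a.1 + a.2 - 1.

Definition pair_of_mark N n (a : mark n) : 'I_N.+1 * 'I_N.+1 :=
  (inord (mark_pos a), inord (mark_len a)).

Lemma pair_of_markE N n (a : mark n) : n <= N ->
  ((pair_of_mark N a).1 = mark_pos a :> nat) *
  ((pair_of_mark N a).2 = mark_len a :> nat).
Proof.
move=> lenN; split; rewrite inordK // (leq_trans (ltn_ord _)) //.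
Qed.

Section FromPerm.
Context (N n : nat) (p : 'S_n) (u : seq nat).
Hypotheses (lenN : n <= N) (su : size u = n) (pu : standardizes p u).

Lemma marks_imset : marks N u = @pair_of_mark N n @: marked_occs G p.
Proof.
apply/setP => -[i m]; rewrite inE /=; apply/exists_inP/imsetP => [[q qG qu]|].
  have /andP[lei _] := qu; rewrite su in lei.
  have lti : i < n.+1 by rewrite ltnS (leq_trans (leq_addr m i)).
  have ltm : m < n.+1 by rewrite ltnS (leq_trans (leq_addl i m)).
  exists (existT (fun m : 'I_n.+1 => 'I_n.+1 * 'S_m)%type
    (Ordinal ltm) (Ordinal lti, q)).
    by rewrite inE (is_occE _ _ su pu); apply/andP.
  by rewrite /pair_of_mark /mark_pos /mark_len /= !inord_val.
case=> a; rewrite inE (is_occE _ _ su pu) => /andP[aG ao].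
have [/= a1 a2] := pair_of_markE a lenN.
move=> [-> ->]; rewrite {}a1.
(* The length is generalized so that the equality of lengths can be substituted in the type of the
   pattern. *)
suff key l (q : 'S_l) : inord (n' := N) (mark_len a) = l :> nat -> q \in G l ->
    occurs q u (mark_pos a) ->
    exists2 q' : 'S_(inord (n' := N) (mark_len a)),
      q' \in G (inord (n' := N) (mark_len a)) & occurs q' u (mark_pos a).
  exact: key a2 aG ao.
by move=> e; subst l; exists q.
Qed.

(** Two patterns of the same length at the same place standardize the same factor, hence
    coincide. *)
Lemma pair_of_mark_inj : {in marked_occs G p &, injective (@pair_of_mark N n)}.
Proof.
move=> a b; rewrite !inE !(is_occE _ _ su pu).
move=> /andP[_ /andP[_ ao]] /andP[_ /andP[_ bo]] eab.
have [a1 a2] := pair_of_markE a lenN.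
have [b1 b2] := pair_of_markE b lenN.
have e1 : mark_pos a = mark_pos b by rewrite -a1 -b1 eab.
have e2 : mark_len a = mark_len b by rewrite -a2 -b2 eab.
move: a b ao bo e1 e2 {a1 a2 b1 b2 eab} => [m [i q]] [m' [i' q']].
rewrite /mark_pat /mark_pos /mark_len /= => qo q'o e1 /val_inj e2; subst m'.
by rewrite -e1 in q'o; rewrite (standardizes_uniq qo q'o) (val_inj e1).
Qed.

Lemma card_marks : #|marks N u| = occ G p.
Proof. by rewrite marks_imset card_in_imset //; apply: pair_of_mark_inj. Qed.

(** With at least two letters there is a gap to cover, so a covering set is automatically nonempty,
    as a cluster must be. *)
Lemma cover_poly_marks (K : comNzRingType) (y : K) : 1 < n ->
  cover_poly y (@pair_lo N) (@pair_hi N) (marks N u) n.-1 =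
  (\sum_(c in clusters G p) y ^+ #|c|)%R.
Proof.
move=> n_gt1; rewrite marks_imset.
rewrite (@cover_poly_imset _ _ _ _ (@mark_pos n)
  (fun a => mark_pos a + mark_len a - 1)).
- apply: eq_bigl => c; rewrite inE.
  have [->|] := eqVneq c set0; last by [].
  apply/andP => -[_ /forallP cov].
  have n1_gt0 : 0 < n.-1 by rewrite -ltnS prednK // ltnW.
  by have /exists_inP[a] := cov (Ordinal n1_gt0); rewrite inE.
- exact: pair_of_mark_inj.
- by move=> a _; rewrite /pair_lo pair_of_markE.
- by move=> a _; rewrite /pair_hi !pair_of_markE.
Qed.

End FromPerm.

Lemma mark_len_ge2 N u (a : 'I_N.+1 * 'I_N.+1) : a \in marks N u -> 2 <= a.2.
Proof. by rewrite inE => /exists_inP[q /hG]. Qed.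

Lemma mark_end_le N u (a : 'I_N.+1 * 'I_N.+1) :
  a \in marks N u -> a.1 + a.2 <= size u.
Proof. by rewrite inE => /exists_inP[q _ /andP[]]. Qed.

Lemma marks_short N u : size u <= 1 -> marks N u = set0.
Proof.
move=> su; apply/setP => a; rewrite [RHS]inE; apply/negP => au.
have := leq_trans (leq_trans (leq_addl _ _) (mark_end_le au)) su.
by rewrite leqNgt (mark_len_ge2 au).
Qed.

Lemma marks_take N u k :
  marks N (take k.+1 u) = [set a in marks N u | pair_hi a <= k].
Proof.
apply/setP => a; rewrite !inE /pair_hi leq_subLR add1n.
have occ_take (q : 'S_(a.2)) :
    occurs q (take k.+1 u) a.1 = occurs q u a.1 && (a.1 + a.2 <= k.+1).
  rewrite /occurs size_take_min leq_min.
  case: (leqP (a.1 + a.2) k.+1) => lek; rewrite ?andbF //= andbT; congr (_ && _).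
  apply: eq_standardizes => b ltb; rewrite !nth_drop nth_take //.
  by rewrite (leq_trans _ lek) // ltn_add2l.
apply/exists_inP/andP => [[q qG]|[/exists_inP[q qG qo] le]].
  by rewrite occ_take => /andP[qo ->]; split=> //; apply/exists_inP; exists q.
by exists q; rewrite // occ_take qo.
Qed.

Lemma card_marks_drop N u k : size u <= N ->
  #|marks N (drop k.+1 u)| = #|[set a in marks N u | k < pair_lo a]|.
Proof.
move=> suN; pose f (a : 'I_N.+1 * 'I_N.+1) : 'I_N.+1 * 'I_N.+1 :=
  (inord (a.1 + k.+1), a.2).
(* The bound on [m] rules out the empty pattern, which would occur in the empty suffix left when
   [k.+1] exceeds the size of [u]. *)
have occ_drop m (q : 'S_m) i : 2 <= m ->
    occurs q (drop k.+1 u) i = occurs q u (i + k.+1).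
  move=> m2; rewrite /occurs drop_drop size_drop addnAC; congr (_ && _).
  have [le|lt] := leqP k.+1 (size u); first by rewrite leq_subRL // addnC.
  rewrite (eqP (ltnW lt)) leqn0 addn_eq0 (gtn_eqF (ltnW m2)) andbF.
  by apply/esym/negbTE; rewrite -ltnNge (leq_trans lt) // leq_addl.
have fE a : a \in marks N (drop k.+1 u) -> (f a).1 = a.1 + k.+1 :> nat.
  move=> au; rewrite inordK // ltnS (leq_trans _ suN) //.
  have := mark_end_le au; have := mark_len_ge2 au.
  rewrite size_drop; lia.
suff -> : [set a in marks N u | k < pair_lo a] = f @: marks N (drop k.+1 u).
  rewrite card_in_imset // => a b au bu eab.
  have e1 : a.1 = b.1.
    by apply: val_inj; apply: (@addIn k.+1); rewrite -!fE // eab.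
  have e2 : a.2 = b.2 by case: eab.
  by case: a b e1 e2 {au bu eab} => [? ?] [? ?] /= -> ->.
apply/setP => a; rewrite inE; apply/andP/imsetP => [[au ka]|[b bu ->]].
  have a1 : inord (n' := N) (a.1 - k.+1) = a.1 - k.+1 :> nat.
    by rewrite inordK // (leq_ltn_trans (leq_subr _ _)).
  exists (inord (a.1 - k.+1), a.2).
    move: au; rewrite !inE /= a1 => /exists_inP[q qG qo]; apply/exists_inP.
    by exists q => //; rewrite occ_drop ?(hG qG) // subnK.
  by rewrite /f /= a1 subnK // inord_val; case: (a).
split; last by rewrite /pair_lo fE // ltn_addl.
have := fE _ bu; move: (bu); rewrite !inE /= => /exists_inP[q qG qo] ->.
by apply/exists_inP; exists q => //; rewrite -occ_drop // (hG qG).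
Qed.

(** * Weights of words and the first-block recursion *)

Section Words.
Context (K : comNzRingType) (y : K).

Definition occ_weight N u : K := ((1 + y) ^+ #|marks N u|)%R.

(** The cluster enumerator for words of at least two letters. A single letter has no gap and gets
    weight 1 from the empty set. *)
Definition cluster_weight N u : K :=
  cover_poly y (@pair_lo N) (@pair_hi N) (marks N u) (size u).-1.

(** If the first uncovered gap is [k], the first block consists of [k.+1] letters, and the marks to
    its right are unrestricted. *)
Lemma occ_weight_first_block N n u : size u = n.+1 -> n < N ->
  (occ_weight N u =
   \sum_(k < n.+1) cluster_weight N (take k.+1 u) * occ_weight N (drop k.+1 u))%R.
Proof.
move=> su ltnN; rewrite /occ_weight.
rewrite (@sum_subset_first_gap _ y _ (@pair_lo N) (@pair_hi N) _ n).
- apply: eq_bigr => k _; rewrite -marks_take -card_marks_drop ?su //.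
  by rewrite /cluster_weight size_take_min su (minn_idPl (ltn_ord k)).
- by move=> a /mark_len_ge2; rewrite /pair_lo /pair_hi; lia.
- by move=> a /mark_end_le; rewrite su /pair_hi; lia.
Qed.

Lemma sum_occ_weight_rec J N n : n < N ->
  (\sum_(w : n.+1.-tuple 'I_J) occ_weight N (letters w) =
   \sum_(k < n.+1) (\sum_(u : k.+1.-tuple 'I_J) cluster_weight N (letters u)) *
     \sum_(v : (n - k).-tuple 'I_J) occ_weight N (letters v))%R.
Proof.
move=> ltnN.
under eq_bigr => w _.
  rewrite (@occ_weight_first_block N n) ?size_map ?size_tuple //; over.
rewrite exchange_big; apply: eq_bigr => -[k ltk] _ /=.
have nE : n.+1 = k.+1 + (n - k) by rewrite addSn subnKC.
rewrite [in LHS]nE (big_tuple_cat _ k.+1 (n - k) (fun w =>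
  cluster_weight N (take k.+1 (letters w)) * occ_weight N (drop k.+1 (letters w)))%R).
rewrite big_distrlr; apply: eq_bigr => u _; apply: eq_bigr => v _ /=.
by rewrite /letters map_cat take_size_cat ?drop_size_cat // size_map size_tuple.
Qed.

Lemma sum_cluster_weight1 J N :
  (\sum_(w : 1.-tuple 'I_J) cluster_weight N (letters w) = J%:R)%R.
Proof.
rewrite (eq_bigr (fun=> 1%R)) => [|w _].
  by rewrite sumr_const card_tuple card_ord expn1.
rewrite /cluster_weight marks_short; last by rewrite size_map size_tuple.
rewrite /cover_poly (big_pred1 set0) ?cards0 // => S.
rewrite subset0 size_map size_tuple /=; case: (S == set0) => //=.
by apply/forallP => -[].
Qed.

End Words.
End Marks.

(** * The generating functions *)

Section Coefficients.
Local Open Scope ring_scope.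
Context (G : forall m : nat, {set 'S_m}).

(** Applied to [fpsC], this presents the polynomial in [var_s] and [var_t] as a constant with
    respect to $x$. *)
Lemma rmorph_A_ides (K L : comNzRingType) (phi : {rmorphism K -> L}) n (s t : K) :
  phi (A_ides G n s t) = A_ides G n (phi s) (phi t).
Proof.
rewrite /A_ides; case: eqP => _; first exact: rmorph1.
by rewrite rmorph_sum; apply: eq_bigr => p _; rewrite rmorphM !rmorphXn.
Qed.

Lemma rmorph_R_ides (K L : comNzRingType) (phi : {rmorphism K -> L}) n (s t : K) :
  phi (R_ides G n s t) = R_ides G n (phi s) (phi t).
Proof.
rewrite /R_ides rmorph_sum; apply: eq_bigr => p _; rewrite rmorphM rmorphXn.
by rewrite rmorph_sum; congr (_ * _); apply: eq_bigr => c _; rewrite rmorphXn.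
Qed.

Hypothesis hG : forall (m : nat) (q : 'S_m), q \in G m -> (2 <= m)%N.

Definition A_series n : fps (fps int) := A_ides G n (fpsC fpsX) fpsX * geom ^+ n.+1.

Definition R_series k : fps (fps int) :=
  R_ides G k (fpsC (fpsX - 1)) fpsX * geom ^+ k.+1.

Lemma A_series0 j : A_series 0 j = 1.
Proof. by rewrite /A_series /A_ides mul1r expr1. Qed.

(** Taking $y = s - 1$ turns $(1 + y)^{occ}$ into $s^{occ}$. *)
Lemma A_series_coef N n j : (n <= N)%N ->
  A_series n j = \sum_(w : n.-tuple 'I_j) occ_weight G (fpsX - 1) N (letters w).
Proof.
move=> lenN; case: (posnP n) => [->|n_gt0].
  rewrite A_series0 (big_tuple0 _ (fun w => occ_weight G (fpsX - 1) N (letters w))).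
  by rewrite /occ_weight marks_short // cards0.
rewrite -(@sum_words_gf _ j n (fun p => fpsX ^+ occ G p)) // => [|p u su pu].
  rewrite /A_series /A_ides gtn_eqF //; congr (fps_coef (_ * _) j).
  by apply: eq_bigr => p _; rewrite rmorphXn.
by rewrite /occ_weight (card_marks _ lenN su pu) [1 + _]addrC subrK.
Qed.

Lemma R_series_coef N k j : (1 < k <= N)%N ->
  R_series k j = \sum_(w : k.-tuple 'I_j) cluster_weight G (fpsX - 1) N (letters w).
Proof.
move=> /andP[k_gt1 lekN].
rewrite -(@sum_words_gf _ j k
  (fun p => \sum_(c in clusters G p) (fpsX - 1) ^+ #|c|)) // => [||p u su pu].
- congr (fps_coef (_ * _) j); apply: eq_bigr => p _; rewrite mulrC rmorph_sum.
  by congr (_ * _); apply: eq_bigr => c _; rewrite rmorphXn.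
- exact: ltnW.
- by rewrite /cluster_weight su (cover_poly_marks _ lekN su pu).
Qed.

(** The coefficient of $x^k$ in the series whose Hadamard powers are summed. *)
Definition block_series k : fps (fps int) :=
  if (2 <= k)%N then R_series k else if k == 1%N then fpsX * geom ^+ 2 else 0.

Lemma block_series_coef N k j : (0 < k <= N)%N ->
  block_series k j =
  \sum_(w : k.-tuple 'I_j) cluster_weight G (fpsX - 1) N (letters w).
Proof.
move=> /andP[k_gt0 lekN]; rewrite /block_series.
have [k_gt1|] := boolP (1 < k)%N; first by apply: R_series_coef; rewrite k_gt1.
rewrite -leqNgt => le1; have -> : k = 1%N by apply/eqP; rewrite eqn_leq le1.
rewrite sum_cluster_weight1 //.
transitivity ((fpsX ^+ 1 * geom ^+ 2 : fps (fps int)) j); first by rewrite expr1.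
(* $t/(1-t)^2$ counts chains with one strict step below [j], that is, single letters. *)
by rewrite (nchain_gf _ [:: true]) /= addn0 sum1_card card_ord.
Qed.

Lemma A_series_rec n j :
  A_series n.+1 j = \sum_(k < n.+1) block_series k.+1 j * A_series (n - k) j.
Proof.
(* The bound [n.+1] accommodates every word in the recursion. *)
rewrite (@A_series_coef n.+1) // sum_occ_weight_rec //.
apply: eq_bigr => k _; rewrite -A_series_coef ?(leq_trans (leq_subr _ _)) //.
by rewrite -block_series_coef // ltn_ord.
Qed.

End Coefficients.

Local Open Scope ring_scope.

Theorem theorem3p8 (G : forall m : nat, {set 'S_m})
    (hG : forall (m : nat) (q : 'S_m), q \in G m -> (2 <= m)%N) :
  let s := var_s in
  let t := var_t in
  let x := var_x in
  let z := x / (1 - t) in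
  let lhs (n : nat) := A_ides G n s t / (1 - t) ^+ n.+1 * x ^+ n in
  let inner (k : nat) := R_ides G k (s - 1) t * z ^+ k in
  let f := t * x / (1 - t) ^+ 2 + (1 - t)^-1 * sum3 2 inner in
  [/\ summable3 0 lhs, summable3 2 inner, summable3 0 (hadamard_exp f)
    & sum3 0 lhs = sum3 0 (hadamard_exp f)].
Proof.
move=> s t x z lhs inner f.
have lhsE : lhs = fun n => fpsC (A_series G n) * var_x ^+ n.
  apply: boolp.funext => n; rewrite /lhs -exprVn inv_1Bt; congr (_ * _).
  by rewrite rmorphM rmorphXn rmorph_A_ides.
have innerE : inner = fun k =>
    fpsC (R_ides G k (fpsC (fpsX - 1)) fpsX * geom ^+ k) * var_x ^+ k.
  apply: boolp.funext => k; rewrite /inner /z inv_1Bt exprMn mulrA mulrAC.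
  by rewrite /s var_sB1 [in RHS]rmorphM rmorphXn rmorph_R_ides.
have lhs_sum : is_sum3 0 lhs (Fps (A_series G)).
  by rewrite lhsE; apply: is_sum3_x.
have inner_sum := is_sum3_x 2 (fun k =>
  R_ides G k (fpsC (fpsX - 1)) fpsX * geom ^+ k).
rewrite -innerE in inner_sum.
(* The factor $1/(1-t)$ in front of the inner sum raises the [geom ^+ k] coming from $z^k$ to the
   exponent [k.+1] of [R_series]. *)
have fE k : f k = block_series G k.
  have -> : f = fpsC (fpsX * geom ^+ 2) * x + fpsC geom * sum3 2 inner.
    by rewrite /f -exprVn inv_1Bt mulrAC [in RHS]rmorphM rmorphXn.
  have -> : block_series G k = if (2 <= k)%N
      then geom * (R_ides G k (fpsC (fpsX - 1)) fpsX * geom ^+ k)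
      else if k == 1%N then fpsX * geom ^+ 2 else 0.
    by rewrite /block_series /R_series exprS mulrCA.
  rewrite (sum3E inner_sum) fpsD_coef !fpsCM_coef.
  rewrite -[x k]/((k == 1%N)%:R) [fps_coef (Fps _) k]/=.
  move: (R_ides _ _ _ _ * _) (fpsX * _) => r a.
  by case: k => [|[|k]] /=; rewrite ?mulr0 ?mulr1 ?addr0 ?add0r.
(* No block has length 0, so the Hadamard powers are summable; the recursion by first blocks
   identifies their sum with the left side. *)
have had_sum : is_sum3 0 (hadamard_exp f) (Fps (A_series G)).
  apply: (@is_sum3_hadamard_exp f (fun j n => A_series G n j)) => [j|j|j n].
  - by rewrite fE.
  - exact: A_series0.
  - rewrite (A_series_rec hG); apply: eq_bigr => k _.
    by rewrite fE.
split; last by rewrite (sum3E lhs_sum) (sum3E had_sum).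
- by exists (Fps (A_series G)).
- by eexists; exact: inner_sum.
- by exists (Fps (A_series G)).
Qed.
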